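(* Let $G$ be a hypertree with strong blocks $G_e=K_{p_e}$ for $e\in E$, the nodes of each clique $G_e$ being labelled by $[p_e]=\{1,\dots,p_e\}$, with block-data given by elements $a_e, m_{e,v}, m'_{e,v}$ ($e\in E$, $v\in[p_e]$) of a commutative unital ring $R$: that is, $D^*_{G_e}$ has diagonal entries $1$ and $(v,w)$ entry $m_{e,v}m'_{e,w}$ for $v\ne w$. Define $\mathbf{d}_e:=\left(\frac{m_{e,v}m'_{e,v}}{1-m_{e,v}m'_{e,v}}\right)_{v\in[p_e]}$ for all $e\in E$. Then $$\kappa(D_{\mathcal{G}})=\prod_{e\in E}\left(a_e^{p_e-1}(1+\mathbf{e}(p_e)^T\mathbf{d}_e)\prod_{v\in[p_e]}(1-m_{e,v}m'_{e,v})\right),$$ $$\det(D_{\mathcal{G}})=\kappa(D_{\mathcal{G}})\left[\sum_{e\in E}\frac{-a_e}{1+\mathbf{e}(p_e)^T\mathbf{d}_e}\left(p_e-1+\sum_{v<w\in[p_e]}\frac{(m_{e,v}-m_{e,w})(m'_{e,v}-m'_{e,w})}{(1-m_{e,v}m'_{e,v})(1-m_{e,w}m'_{e,w})}\right)\right],$$ $$\operatorname{cof}(D_{\mathcal{G}})=\kappa(D_{\mathcal{G}})\left[1+\sum_{e\in E}\frac{1}{1+\mathbf{e}(p_e)^T\mathbf{d}_e}\left(p_e-1+\sum_{v<w\in[p_e]}\frac{(m_{e,v}-m_{e,w})(m'_{e,v}-m'_{e,w})}{(1-m_{e,v}m'_{e,v})(1-m_{e,w}m'_{e,w})}\right)\right].$$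 All denominators (including those in $\mathbf{d}_e$) are placeholders, which cancel with factors of the products in $\kappa(D_{\mathcal{G}})$ so that each right-hand side is a polynomial in the $a_e,m_{e,v},m'_{e,v}$.
   Context: Graphs are finite, simple, directed and strongly connected. A cut-vertex is a vertex whose removal disconnects the underlying undirected graph; the strong blocks of $G$ are its maximal (connected) subgraphs without cut-vertices of their own, indexed by $E$. A hypertree is a graph all of whose strong blocks are (bidirected) complete graphs. $\mathbf{e}(p)$ is the all-ones column vector of length $p$, $\mathbf{e}$ is an all-ones column vector and $J=\mathbf{e}\mathbf{e}^T$ an all-ones square matrix, of the dimension dictated by context. For a square matrix $A$ over $R$, $\operatorname{cof}(A):=\mathbf{e}^T\mathrm{adj}(A)\mathbf{e}$ is the sum of all cofactors of $A$. Given scalars $a_e\in R$ and matrices $D^*_{G_e}\in R^{p_e\times p_e}$ with unit diagonal (here: as in the claim), the multiplicative distance matrix $D^*_G=(m_{ij})_{i,j\in V(G)}$ has principal submatrix $D^*_{G_e}$ on $V(G_e)$, and for $i,j$ not in a common block, inductively $m_{ij}:=m_{iv}m_{vj}$ where $v\neq i,j$ is any cut-vertex separating $i$ from $j$ (independent of the choice of $v$). The additive-multiplicative distance matrix $D_{\mathcal{G}}=(d_{ij})_{i,j\in V(G)}$ has principal submatrix $a_e(D^*_{G_e}-J)$ on $V(G_e)$, and for $i,j$ not in a common block, inductively $d_{ij}:=d_{iv}+m_{iv}d_{vj}$ where $v\neq i,j$ is any cut-vertex separating $i$ from $j$. Invariant $\kappa$: for any vertex $v_0$ of $G$, with vertex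 set $V$, order the vertices with $v_0$ last and write $D_{\mathcal{G}}=\begin{pmatrix}D_1&\mathbf{u}_1\\ \mathbf{w}_1^T&0\end{pmatrix}$ with $D_1$ the principal submatrix on $V\setminus\{v_0\}$, and let $\mathbf{m}=(m_{vv_0})_{v\in V\setminus\{v_0\}}$. Then $\kappa(D_{\mathcal{G}}):=\det(D_1-\mathbf{u}_1\mathbf{e}^T-\mathbf{m}\mathbf{w}_1^T)$; this does not depend on $v_0$, and equals $\det(D^*_G)\prod_{e\in E}a_e^{p_e-1}$. *)

(* Defs.v *)
From mathcomp Require Import all_boot all_order all_algebra.
From mathcomp Require Import fraction mpoly.

Set Implicit Arguments.
Unset Strict Implicit.
Unset Printing Implicit Defensive.

Import GRing.Theory.
Local Open Scope ring_scope.

Section Graphs.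

Context (n : nat).
Implicit Types (g : rel 'I_n) (S B : {set 'I_n}) (u v i j : 'I_n).

Definition simple_digraph g := irreflexive g.

Definition strongly_connected g := forall i j, connect g i j.

(* i and j are joined by a path of the underlying undirected graph of the
   subgraph of g induced on S. *)
Definition joined_in g S i j : bool :=
  connect (fun u v => [&& u \in S, v \in S & g u v || g v u]) i j.

Definition connected_on g S : bool :=
  [forall i in S, [forall j in S, joined_in g S i j]].

(* The removal of v leaves a disconnected graph; by convention the graph without
   vertices is connected, so that a one-vertex graph has no cut-vertex. *)
Definition cut_vertex g S v : bool :=
  (v \in S) && ~~ connected_on g (S :\ v).

(* A maximal subgraph that is connected and has no cut-vertex contains all the
   edges of g between its vertices, hence it is given by its vertex set. *)
Definition strong_block g B : bool :=
  maxset (fun S => connected_on g S && [forall v, ~~ cut_vertex g S v]) B.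

Definition hypertree g : Prop :=
  [/\ simple_digraph g, strongly_connected g &
      forall B, strong_block g B -> {in B &, forall i j, i != j -> g i j}].

Definition separates g v i j : Prop :=
  [/\ cut_vertex g [set: 'I_n] v, v != i, v != j &
      ~~ joined_in g [set~ v] i j].

Definition in_common_block g i j : Prop :=
  exists B, [/\ strong_block g B, i \in B & j \in B].

(* The strong blocks of g are listed without repetition by E, and node e labels
   the vertices of the block e by 'I_(p e), which stands for {1, ..., p_e}. *)
Definition block_labelling g (E : finType) (p : E -> nat)
    (node : forall e, 'I_(p e) -> 'I_n) : Prop :=
  [/\ forall e, injective (node e),
      injective (fun e => [set node e v | v : 'I_(p e)]) &
      forall B, strong_block g B <->
                exists e, B = [set node e v | v : 'I_(p e)]].

End Graphs.

Definition block_mul_mx (R : comNzRingType) (q : nat) (m m' : 'I_q -> R) :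
    'M[R]_q :=
  \matrix_(v, w) (if v == w then 1 else m v * m' w).

Definition block_addmul_mx (R : comNzRingType) (q : nat) (a : R)
    (m m' : 'I_q -> R) : 'M[R]_q :=
  a *: (block_mul_mx m m' - const_mx 1).

Section DistanceMatrices.

Context (n : nat) (g : rel 'I_n) (E : finType) (p : E -> nat).
Context (node : forall e, 'I_(p e) -> 'I_n) (R : comNzRingType).
Context (a : E -> R) (m m' : forall e, 'I_(p e) -> R).

Definition mul_distance_mx (M : 'M[R]_n) : Prop :=
  (forall e v w, M (node v) (node w) = block_mul_mx (@m e) (@m' e) v w) /\
  (forall i j v, ~ in_common_block g i j -> separates g v i j ->
     M i j = M i v * M v j).

Definition addmul_distance_mx (M D : 'M[R]_n) : Prop :=
  (forall e v w,
     D (node v) (node w) = block_addmul_mx (a e) (@m e) (@m' e) v w) /\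
  (forall i j v, ~ in_common_block g i j -> separates g v i j ->
     D i j = D i v + M i v * D v j).

End DistanceMatrices.

Definition cof (R : comNzRingType) (n : nat) (A : 'M[R]_n) : R :=
  ((const_mx 1 : 'rV_n) *m \adj A *m (const_mx 1 : 'cV_n)) 0 0.

(* The invariant kappa of the additive-multiplicative distance matrix D with
   multiplicative part M, computed from the vertex v0. *)
Definition kappa (R : comNzRingType) (n : nat) (M D : 'M[R]_n.+1)
    (v0 : 'I_n.+1) : R :=
  let D1 : 'M_n := row' v0 (col' v0 D) in
  let u1 : 'cV_n := row' v0 (col v0 D) in
  let w1T : 'rV_n := col' v0 (row v0 D) in
  let mv : 'cV_n := row' v0 (col v0 M) in
  \det (D1 - u1 *m (const_mx 1 : 'rV_n) - mv *m w1T).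

Section RightHandSides.

Context (F : fieldType) (E : finType) (p : E -> nat).
Context (a : E -> F) (m m' : forall e, 'I_(p e) -> F).

Definition dvec (e : E) : 'cV[F]_(p e) :=
  \col_v (m v * m' v / (1 - m v * m' v)).

Definition one_plus_sum_d (e : E) : F :=
  1 + ((const_mx 1 : 'rV_(p e)) *m dvec e) 0 0.

Definition pair_sum (e : E) : F :=
  (p e)%:R - 1 +
  \sum_(v < p e) \sum_(w < p e | (v < w)%N)
     (m v - m w) * (m' v - m' w) / ((1 - m v * m' v) * (1 - m w * m' w)).

Definition kappa_rhs : F :=
  \prod_e (a e ^+ (p e).-1 * one_plus_sum_d e *
           \prod_(v < p e) (1 - m v * m' v)).

Definition det_rhs : F :=
  kappa_rhs * \sum_e (- a e / one_plus_sum_d e * pair_sum e).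

Definition cof_rhs : F :=
  kappa_rhs * (1 + \sum_e (1 / one_plus_sum_d e * pair_sum e)).

End RightHandSides.

(* The right-hand sides are rational functions in indeterminates a_e, m_{e,v},
   m'_{e,v} over the integers; they turn out to be polynomials, and it is these
   polynomials that are evaluated at the given elements of the ring R, in which
   the denominators need not be invertible. *)
Section PlaceholderDenominators.

Context (E : finType) (p : E -> nat).

Definition indet : finType :=
  (E + ({e : E & 'I_(p e)} + {e : E & 'I_(p e)}))%type.

Definition data_poly := {mpoly int[#|indet|]}.

Definition data_ratfun := {fraction data_poly}.

Definition indet_fun (x : indet) : data_ratfun :=
  tofrac ('X_(enum_rank x) : data_poly).

Definition gen_a (e : E) : data_ratfun := indet_fun (inl e).

Definition gen_m (e : E) (v : 'I_(p e)) : data_ratfun :=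
  indet_fun (inr (inl (Tagged (fun e => 'I_(p e)) v))).

Definition gen_m' (e : E) (v : 'I_(p e)) : data_ratfun :=
  indet_fun (inr (inr (Tagged (fun e => 'I_(p e)) v))).

Definition indet_val (R : comNzRingType) (a : E -> R)
    (m m' : forall e, 'I_(p e) -> R) (x : indet) : R :=
  match x with
  | inl e => a e
  | inr (inl u) => m (tag u) (tagged u)
  | inr (inr u) => m' (tag u) (tagged u)
  end.

Definition eval_data (R : comNzRingType) (a : E -> R)
    (m m' : forall e, 'I_(p e) -> R) (P : data_poly) : R :=
  mmap intr (fun k => indet_val a m m' (enum_val k)) P.

(* The polynomial P is unique since tofrac is injective. *)
Definition is_polynomial_with_value (R : comNzRingType) (a : E -> R)
    (m m' : forall e, 'I_(p e) -> R) (f : data_ratfun) (x : R) : Prop :=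
  exists2 P : data_poly, tofrac P = f & eval_data a m m' P = x.

End PlaceholderDenominators.

(* Main.v *)
(* Over any commutative ring, write phi(u) = e^T adj(D) u; then det(D + u e^T)
   = det D + phi(u), so that cof D = phi(e), and row and column operations
   show that the invariant kappa computed from v0 is phi(m_{. v0}). A
   hypertree is built from one vertex by attaching its blocks one at a time,
   each along a single vertex c which separates the new vertices from the
   old ones. Subtracting m_{ic} times row c from each new row i, and column
   c from each new column, leaves a matrix whose off-diagonal blocks have
   rank one, and this gives recurrences for det D and for phi. They make
   kappa multiplicative over the blocks, while the increments of det and cof
   are -a_e nu_e and nu_e times the kappas of the other blocks, where nu_e =
   a_e^(p_e - 1) (cof D*_e - det D*_e). As D*_e is a rank one perturbation
   of a diagonal matrix, det D*_e and cof D*_e are computed explicitly over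
   the field of fractions of the universal polynomial ring; the quantities
   themselves are polynomials, hence specialize to the given ring. *)
Require Import Defs.
From mathcomp Require Import all_boot all_order all_algebra.
From mathcomp Require Import perm fraction mpoly ring.

Set Implicit Arguments.
Unset Strict Implicit.
Unset Printing Implicit Defensive.

Import GRing.Theory.
Local Open Scope ring_scope.

(** * Adjugate forms and determinants of rank one perturbations *)

Definition adjform (R : comNzRingType) n (v : 'rV[R]_n) (A : 'M_n)
    (u : 'cV_n) : R :=
  (v *m \adj A *m u) 0 0.

Lemma adjform_map (R S : comNzRingType) (f : {rmorphism R -> S}) n
    (v : 'rV_n) (A : 'M_n) (u : 'cV_n) :
  adjform (map_mx f v) (map_mx f A) (map_mx f u) = f (adjform v A u).
Proof. by rewrite /adjform -map_mx_adj -!map_mxM mxE. Qed.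

Section AdjugateForm.

Context (R : comNzRingType).

Lemma adjform_mxE n (v : 'rV[R]_n) A u : v *m \adj A *m u = (adjform v A u)%:M.
Proof. by apply/matrixP=> i j;
  rewrite (ord1 i) (ord1 j) [RHS]mxE eqxx mulr1n. Qed.

Lemma adjformDr n (v : 'rV[R]_n) A u1 u2 :
  adjform v A (u1 + u2) = adjform v A u1 + adjform v A u2.
Proof. by rewrite /adjform mulmxDr mxE. Qed.

Lemma adjformZr n (v : 'rV[R]_n) A c u :
  adjform v A (c *: u) = c * adjform v A u.
Proof. by rewrite /adjform -scalemxAr mxE. Qed.

Lemma adjformZl n (v : 'rV[R]_n) A c u :
  adjform (c *: v) A u = c * adjform v A u.
Proof. by rewrite /adjform -!scalemxAl mxE. Qed.

Lemma adjform0r n (v : 'rV[R]_n) A : adjform v A 0 = 0.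
Proof. by rewrite /adjform mulmx0 mxE. Qed.

Lemma adjformNr n (v : 'rV[R]_n) A u : adjform v A (- u) = - adjform v A u.
Proof. by rewrite -scaleN1r adjformZr mulN1r. Qed.

Lemma adjform_mul n (v : 'rV[R]_n) A (w : 'cV_n) :
  adjform v A (A *m w) = \det A * (v *m w) 0 0.
Proof.
by rewrite /adjform mulmxA -(mulmxA v) mul_adj_mx mul_mx_scalar -scalemxAl mxE.
Qed.

End AdjugateForm.

Lemma det_adjM (R : comNzRingType) n (A : 'M[R]_n) :
  \det (\adj A) * \det A = \det A ^+ n.
Proof. by rewrite -det_mulmx mul_adj_mx det_scalar. Qed.

Section Regular.

Context (R : comNzRingType) (k : nat) (A : 'M[R]_k).
Hypothesis regA : GRing.lreg (\det A).

(** The bordered matrix with corner [1] has Schur complement [A + u *m v]. Eliminating the border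
    the other way would need the inverse of [A]; using [\adj A] instead costs a power of [\det A],
    which regularity cancels. *)
Lemma det_rank1_regular (u : 'cV_k) (v : 'rV_k) :
  \det (A + u *m v) = \det A + adjform v A u.
Proof.
have blockE : \det (block_mx A (- u) v (1%:M : 'M_1)) = \det (A + u *m v).
  transitivity (\det (block_mx A (- u) v (1%:M : 'M_1) *m
                      block_mx 1%:M 0 (- v) 1%:M)).
    by rewrite det_mulmx det_lblock !det1 !mulr1.
  rewrite mulmx_block !mulmx1 !mulmx0 !add0r mul1mx mulmxN mulNmx opprK subrr.
  by rewrite det_ublock det1 mulr1.
apply: (lregX (n := k) regA); rewrite -[in LHS]det_adjM -blockE mulrC.
transitivity (\det (block_mx A (- u) v (1%:M : 'M_1) *m
                    block_mx (\adj A) (\adj A *m u) 0 (\det A)%:M)).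
  by rewrite det_mulmx det_ublock det_scalar expr1.
rewrite mulmx_block !mulmx0 !addr0 mul_mx_adj mul1mx mulmxA mul_mx_adj.
rewrite mul_scalar_mx mul_mx_scalar scalerN subrr det_lblock det_scalar.
by rewrite mulmxA adjform_mxE -raddfD det_scalar expr1 addrC.
Qed.

End Regular.

Section Universal.

Context (R : comNzRingType).

(* Adding the variable of a polynomial ring to the diagonal makes the
   determinant monic, hence cancellable. *)
Definition shift_mx n (A : 'M[R]_n) : 'M[{poly R}]_n := char_poly_mx (- A).

Lemma shift_mx_lreg n (A : 'M[R]_n) : GRing.lreg (\det (shift_mx A)).
Proof. exact/monic_lreg/char_poly_monic. Qed.

Lemma shift_mx0 n (A : 'M[R]_n) : map_mx (horner_eval 0) (shift_mx A) = A.
Proof.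
apply/matrixP=> i j; rewrite !mxE /horner_eval /= !hornerE.
by rewrite hornerMn hornerX mul0rn add0r opprK.
Qed.

Lemma horner_map_polyC n p (A : 'M[R]_(n, p)) :
  map_mx (horner_eval 0) (map_mx polyC A) = A.
Proof. by apply/matrixP=> i j; rewrite !mxE /horner_eval hornerC. Qed.

(** The matrix determinant lemma holds over the polynomial ring for [A] with the variable added to
    its diagonal; setting the variable to [0] gives it for [A]. *)
Lemma det_rank1 k (A : 'M[R]_k) (u : 'cV_k) (v : 'rV_k) :
  \det (A + u *m v) = \det A + adjform v A u.
Proof.
pose f : {rmorphism {poly R} -> R} := horner_eval 0.
have := det_rank1_regular (@shift_mx_lreg _ A) (map_mx polyC u) (map_mx polyC
  v).
move/(congr1 f); rewrite rmorphD /= -!(det_map_mx f) -(adjform_map f).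
by rewrite map_mxD map_mxM shift_mx0 !horner_map_polyC.
Qed.

End Universal.

(** Block elimination with [\adj A] clears the upper right corner and turns [C] into
    [d *: C - t *: z *m w], again a rank one perturbation. Both sides then carry the factor
    [d ^+ (k + q)], which is cancelled. *)
Lemma det_outer_block_regular (R : comNzRingType) k q (A : 'M[R]_k) (C : 'M_q)
    (u : 'cV_k) (w : 'rV_q) (z : 'cV_q) (v : 'rV_k) : GRing.lreg (\det A) ->
  \det (block_mx A (u *m w) (z *m v) C) =
  \det A * \det C - adjform v A u * adjform w C z.
Proof.
move=> regA; apply: (lregX (n := k + q) regA).
set d := \det A; set t := adjform v A u.
transitivity (d * \det (block_mx A (u *m w) (z *m v) C *m
  block_mx (\adj A) (- (\adj A *m u *m w)) 0 d%:M)).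
  rewrite det_mulmx det_ublock det_scalar exprD -(det_adjM A) -/d; ring.
rewrite mulmx_block !mulmx0 !addr0 mul_mx_adj mulmxN !mulmxA mul_mx_adj.
rewrite mul_scalar_mx mul_mx_scalar -scalemxAl addNr det_lblock det_scalar.
have -> : z *m v *m - (\adj A *m u *m w) + C *m d%:M = d *: C + (- t *: z) *m w.
  rewrite mulmxN !mulmxA -(mulmxA z) -(mulmxA z) adjform_mxE mul_mx_scalar.
  by rewrite mul_mx_scalar scaleNr mulNmx addrC.
rewrite det_rank1 detZ -/d.
(* The adjugate of a scaled matrix of size [q] scales by the power [q.-1], which is truncated at
   [q = 0]; there the form vanishes because [w] is empty. *)
case: q C w z => [|q] C w z.
  rewrite !addn0 /adjform (thinmx0 w) !mul0mx !mxE expr0; ring.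
rewrite adjformZr /adjform adjZ /= -scalemxAr -scalemxAl !mxE exprD exprS; ring.
Qed.

Lemma det_outer_block (R : comNzRingType) k q (A : 'M[R]_k) (C : 'M_q)
    (u : 'cV_k) (w : 'rV_q) (z : 'cV_q) (v : 'rV_k) :
  \det (block_mx A (u *m w) (z *m v) C) =
  \det A * \det C - adjform v A u * adjform w C z.
Proof.
pose f : {rmorphism {poly R} -> R} := horner_eval 0.
have := det_outer_block_regular (map_mx polyC C) (map_mx polyC u)
  (map_mx polyC w) (map_mx polyC z) (map_mx polyC v) (@shift_mx_lreg _ _ A).
move/(congr1 f); rewrite rmorphB !rmorphM /= -!(det_map_mx f) -!(adjform_map f).
by rewrite map_block_mx !map_mxM shift_mx0 !horner_map_polyC.
Qed.

(** Both sides become [\det (A + (u + w) *m v)] once [\det (A + u *m v)] is added. *)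
Lemma adjform_rank1 (R : comNzRingType) n (A : 'M[R]_n) (u w : 'cV_n) v :
  adjform v (A + u *m v) w = adjform v A w.
Proof.
apply: (@addrI _ (\det (A + u *m v))).
by rewrite -det_rank1 -addrA -mulmxDl !det_rank1 adjformDr addrA.
Qed.

Local Notation ones := (const_mx 1 : 'rV__).

(** * Attaching new vertices along a single old vertex *)

Section Attach.

Context (R : comNzRingType) (k q : nat) (A : 'M[R]_k) (c : 'I_k).
Context (mc : 'cV[R]_k) (wd : 'rV[R]_q) (zb db : 'cV[R]_q) (Bl : 'M[R]_q).
Hypotheses (Acc : A c c = 0) (mcc : mc c 0 = 1).

(* The vertices of [Bl] are attached at the vertex [c] of [A]: [mc] and [zb] are
   the old and new parts of column [c] of the multiplicative matrix, [db] and
   [wd] the new parts of column and row [c] of the additive-multiplicative one. *)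
Definition attach_mx : 'M_(k + q) :=
  block_mx A (col c A *m ones + mc *m wd) (db *m ones + zb *m row c A) Bl.

(** This is what remains of [Bl] after subtracting [zb] times row [c] from the new rows and column
    [c] from the new columns. It has the shape of the matrix whose determinant is [kappa] computed
    from [c]. *)
Definition attach_core : 'M_q := Bl - db *m ones - zb *m wd.

(** The arbitrary shift by a multiple of the all-ones row lets one elimination yield the recurrences
    for both the determinant and the adjugate form. *)
Lemma det_attach_shift (u1 : 'cV_k) (u2 : 'cV_q) :
  \det (attach_mx + col_mx u1 u2 *m ones) =
  \det (A + u1 *m ones) * \det attach_core -
  adjform ones A mc * adjform wd attach_core (db + u2 - u1 c 0 *: zb).
Proof.
pose dc : 'rV[R]_k := delta_mx 0 c.
have onesD : ones = row_mx ones ones :> 'rV[R]_(k + q) by rewrite row_mx_const.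
have u1c : u1 c 0 *: zb = zb *m (dc *m u1).
  by rewrite -rowE [row _ _]mx11_scalar mul_mx_scalar mxE.
have dcA : row c A = dc *m A by rewrite -rowE.
have dcmc : dc *m mc = 1%:M.
  by rewrite -rowE [row _ _]mx11_scalar mxE mcc.
have dcAc : dc *m col c A = 0.
  by rewrite -rowE [row _ _]mx11_scalar !mxE Acc raddf0.
have colA : col c A = A *m dc^T by rewrite trmx_delta -colE.
have onesc : ones *m dc^T = 1%:M :> 'M[R]_1.
  by rewrite trmx_delta -colE [col _ _]mx11_scalar !mxE.
(* The two unitriangular factors carry out the row and column operations based at [c]. *)
transitivity (\det (block_mx 1%:M 0 (- (zb *m dc)) 1%:M *m
  (attach_mx + col_mx u1 u2 *m ones) *m block_mx 1%:M (- (dc^T *m ones)) 0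
    1%:M)).
  by rewrite !det_mulmx det_lblock det_ublock !det1 !mulr1 !mul1r.
(* The form of [A] is also that of the shifted [A], which is the upper left block here. *)
rewrite -(adjform_rank1 A u1 mc ones) -det_outer_block; congr (\det _).
rewrite /attach_mx onesD mul_col_row add_block_mx !mulmx_block.
rewrite !mul1mx !mulmx1 !mul0mx !mulmx0 !addr0 ?add0r.
have -> : (A + u1 *m ones) *m - (dc^T *m ones) + (col c A *m ones + mc *m wd +
  u1 *m ones) = mc *m wd.
  rewrite mulmxN mulmxA mulmxDl -colA -mulmxA onesc mulmx1 mulmxDl.
  move: (col c A *m _) (mc *m _) (u1 *m _) => x y z.
  by apply/matrixP=> i j; rewrite !mxE; ring.
have -> : - (zb *m dc) *m (A + u1 *m ones) + (db *m ones + zb *m row c A + u2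
  *m ones)
    = (db + u2 - u1 c 0 *: zb) *m ones.
  rewrite u1c dcA mulmxDr !mulNmx !mulmxDl mulNmx !mulmxA.
  move: (zb *m dc *m A) (zb *m dc *m u1 *m _) (db *m _) (u2 *m _) => x y z t.
  by apply/matrixP=> i j; rewrite !mxE; ring.

congr block_mx.
rewrite mulmxN mulmxA -(mulmxA _ ones) onesc mulmx1 u1c /attach_core.
rewrite mulNmx !mulmxDr !mulmxA -(mulmxA zb dc (col c A)) dcAc mulmx0 mul0mx
  add0r.
rewrite -(mulmxA zb dc mc) dcmc mulmx1 !mulmxDl !mulNmx ?mulmxA.
move: (zb *m wd) (zb *m dc *m u1 *m _) (db *m _) (u2 *m _) => x y z t.
by apply/matrixP=> i j; rewrite !mxE; ring.
Qed.

Lemma det_attach :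
  \det attach_mx =
  \det A * \det attach_core - adjform ones A mc * adjform wd attach_core db.
Proof.
have := det_attach_shift 0 0.
by rewrite col_mx0 !mul0mx !addr0 mxE scale0r subr0.
Qed.

(** By [det_rank1] the form is the difference between the shifted and the unshifted determinant. *)
Lemma adjform_attach (u1 : 'cV_k) (u2 : 'cV_q) :
  adjform ones attach_mx (col_mx u1 u2) =
  adjform ones A u1 * \det attach_core -
  adjform ones A mc * adjform wd attach_core (u2 - u1 c 0 *: zb).
Proof.
apply: (@addrI _ (\det attach_mx)).
rewrite -det_rank1 det_attach_shift det_attach -[db + u2 - _]addrA (adjformDr _
  _ db) det_rank1.
ring.
Qed.

End Attach.

(** * Relabelling of vertices, and a block seen from one of its vertices *)

Section Reindexing.

Context (R : comNzRingType).

(** The same permutation acts on rows and columns, so its sign is squared. The sizes are related by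
    an equation because those produced by gluing are not syntactically [n]. *)
Lemma det_mxsub_inj k n (f : 'I_k -> 'I_n) (A : 'M[R]_n) :
  injective f -> k = n -> \det (mxsub f f A) = \det A.
Proof.
move=> injf kn; move: f injf; rewrite kn => f injf.
have -> : mxsub f f A = row_perm (perm injf) (col_perm (perm injf) A).
  by apply/matrixP=> i j; rewrite !mxE !permE.
rewrite row_permE col_permE !det_mulmx !det_perm odd_permV mulrCA -expr2.
by rewrite sqrr_sign mulr1.
Qed.

Lemma adjform_mxsub_inj k n (f : 'I_k -> 'I_n) (A : 'M[R]_n) (u : 'cV_n) :
  injective f -> k = n ->
  adjform ones (mxsub f f A) (rowsub f u) = adjform ones A u.
Proof.
move=> injf kn; apply: (@addrI _ (\det A)).
rewrite -det_rank1 -{1}(det_mxsub_inj A injf kn) -det_rank1.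
rewrite -(det_mxsub_inj (A + _) injf kn); congr (\det _).
by apply/matrixP=> i j; rewrite !mxE !big_ord1 !mxE.
Qed.

Definition glue (T : Type) k q (f : 'I_k -> T) (h : 'I_q -> T) (i : 'I_(k + q))
  : T :=
  match split i with inl j => f j | inr j => h j end.

Lemma glueP (T : Type) k q (f : 'I_k -> T) (h : 'I_q -> T) (i : 'I_(k + q)) :
  (exists j, glue f h i = f j) \/ (exists j, glue f h i = h j).
Proof. by rewrite /glue; case: split => j; [left|right]; exists j. Qed.

Lemma glue_inj (T : eqType) k q (f : 'I_k -> T) (h : 'I_q -> T) :
  injective f -> injective h -> (forall i j, f i != h j) -> injective (glue f
    h).
Proof.
move=> injf injh fh i j; rewrite /glue -{2}(splitK i) -{2}(splitK j).
case: (split i) => i'; case: (split j) => j' //= E.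
- by rewrite (injf _ _ E).
- by have := fh i' j'; rewrite E eqxx.
- by have := fh j' i'; rewrite E eqxx.
- by rewrite (injh _ _ E).
Qed.

Lemma mxsub_glue n k q (f : 'I_k -> 'I_n) (h : 'I_q -> 'I_n) (A : 'M[R]_n) :
  mxsub (glue f h) (glue f h) A =
  block_mx (mxsub f f A) (mxsub f h A) (mxsub h f A) (mxsub h h A).
Proof.
apply/matrixP=> i j; rewrite !mxE /glue.
by case: split => i'; rewrite !mxE; case: split => j'; rewrite !mxE.
Qed.

Lemma mxsub_gluel n n' r k q (f : 'I_k -> 'I_n) (h : 'I_q -> 'I_n)
    (g : 'I_r -> 'I_n') (A : 'M[R]_(n, n')) :
  mxsub (glue f h) g A = col_mx (mxsub f g A) (mxsub h g A).
Proof.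
by apply/matrixP=> i j; rewrite !mxE /glue; case: split => i'; rewrite !mxE.
Qed.

Definition core n q (M D : 'M[R]_n) (c : 'I_n) (h : 'I_q -> 'I_n) : 'M_q :=
  attach_core (mxsub (fun=> c) h D) (mxsub h (fun=> c) M)
    (mxsub h (fun=> c) D) (mxsub h h D).

Lemma mxsub_glue_attach n k q (M D : 'M[R]_n) (f : 'I_k -> 'I_n)
    (h : 'I_q -> 'I_n) (c : 'I_k) :
  (forall i j, D (f i) (h j) = D (f i) (f c) + M (f i) (f c) * D (f c) (h j)) ->
  (forall i j, D (h i) (f j) = D (h i) (f c) + M (h i) (f c) * D (f c) (f j)) ->
  mxsub (glue f h) (glue f h) D =
  attach_mx (mxsub f f D) c (mxsub f (fun=> f c) M) (mxsub (fun=> f c) h D)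
    (mxsub h (fun=> f c) M) (mxsub h (fun=> f c) D) (mxsub h h D).
Proof.
move=> Dfh Dhf; rewrite mxsub_glue; congr block_mx.
  by apply/matrixP=> i j; rewrite !mxE !big_ord1 !mxE mulr1.
by apply/matrixP=> i j; rewrite !mxE !big_ord1 !mxE mulr1.
Qed.

Section Rooted.

Context (q : nat) (c : 'I_q) (M D : 'M[R]_q).
Hypotheses (Dcc : D c c = 0) (Mcc : M c c = 1).

(** A matrix is viewed as obtained from the one-vertex graph on [c] by attaching all other vertices
    at [c]; the old part is then the zero matrix of size one. *)
Let s := glue (fun _ : 'I_1 => c) (lift c).

Let s_inj : injective s.
Proof.
apply: glue_inj => [i j _||_ j]; last exact: neq_lift; last exact: lift_inj.
by rewrite (ord1 i) (ord1 j).
Qed.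

Let s_size : (1 + q.-1)%N = q.
Proof. by rewrite add1n prednK // (leq_ltn_trans _ (ltn_ord c)). Qed.

Let subE : mxsub s s D =
  attach_mx (mxsub (fun=> c) (fun=> c) D) ord0 (mxsub (fun=> c) (fun=> c) M)
    (mxsub (fun=> c) (lift c) D) (mxsub (lift c) (fun=> c) M)
    (mxsub (lift c) (fun=> c) D) (mxsub (lift c) (lift c) D).
Proof.
apply: (mxsub_glue_attach (f := fun _ : 'I_1 => c) (c := ord0)) => i j.
  by rewrite Dcc Mcc add0r mul1r.
by rewrite Dcc mulr0 addr0.
Qed.

Let A1 (v w : 'M[R]_1) : adjform v (mxsub (fun=> c) (fun=> c) D) w =
  v 0 0 * w 0 0.
Proof.
rewrite /adjform !mxE big_ord1 !mxE big_ord1 !mxE /cofactor.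
by rewrite det_mx00 mulr1 addn0 expr0 mulr1.
Qed.

Lemma det_core : \det D = - adjform (mxsub (fun=> c) (lift c) D)
  (core M D c (lift c)) (mxsub (lift c) (fun=> c) D).
Proof.
rewrite -(det_mxsub_inj D s_inj s_size) subE det_attach ?mxE //.
by rewrite A1 det_mx11 !mxE Dcc Mcc mul0r mul1r mul1r sub0r.
Qed.

Lemma adjform_core (u : 'cV_q) : adjform ones D u =
  u c 0 * \det (core M D c (lift c)) - adjform (mxsub (fun=> c) (lift c) D)
  (core M D c (lift c)) (rowsub (lift c) u - u c 0 *: mxsub (lift c) (fun=> c)
    M).
Proof.
rewrite -(adjform_mxsub_inj _ _ s_inj s_size) subE mxsub_gluel.
by rewrite adjform_attach ?mxE // !A1 !mxE Mcc !mul1r.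
Qed.

End Rooted.

(** For column [v0] of [M] the correction term of [adjform_core] vanishes, leaving the determinant
    that defines [kappa]. *)
Lemma kappaE n (M D : 'M[R]_n.+1) (v0 : 'I_n.+1) :
  D v0 v0 = 0 -> M v0 v0 = 1 -> kappa M D v0 = adjform ones D (col v0 M).
Proof.
move=> D0 M0; rewrite (adjform_core D0 M0) mxE M0 scale1r mul1r.
have -> : rowsub (lift v0) (col v0 M) = mxsub (lift v0) (fun=> v0) M.
  by apply/matrixP=> i j; rewrite !mxE.
rewrite subrr adjform0r subr0 /kappa /core /attach_core.
apply: (congr1 (@determinant R n)); apply/matrixP=> i j.
by rewrite !mxE !big_ord1 !mxE.
Qed.

Section Block.

Context (q : nat) (c : 'I_q) (B : 'M[R]_q).
Hypothesis Bcc : B c c = 1.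

Let D (a : R) := a *: (B - const_mx 1).

Let Dcc a : D a c c = 0.
Proof. by rewrite !mxE Bcc subrr mulr0. Qed.

(** The column of [B] inside the core does not scale with [a], but it multiplies a row that does. *)
Let coreZ a : core B (D a) c (lift c) = a *: core B (D 1) c (lift c).
Proof. by apply/matrixP=> i j; rewrite !mxE !big_ord1 !mxE; ring. Qed.

Let D1 : B = D 1 + const_mx 1 *m ones.
Proof. by apply/matrixP=> i j; rewrite !mxE big_ord1 !mxE; ring. Qed.

Let detB : \det B = \det (D 1) + cof (D 1).
Proof. by rewrite [in LHS]D1 det_rank1. Qed.

Let cofB : cof B = cof (D 1).
Proof. by rewrite [in LHS]D1 [LHS]adjform_rank1. Qed.

Let zb1 : mxsub (lift c) (fun _ : 'I_1 => c) (D 1) =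
  mxsub (lift c) (fun=> c) B - const_mx 1.
Proof. by apply/matrixP=> i j; rewrite !mxE mul1r. Qed.

Let detD1 : \det (D 1) = - adjform (mxsub (fun=> c) (lift c) (D 1))
  (core B (D 1) c (lift c)) (mxsub (lift c) (fun=> c) B - const_mx 1).
Proof. by rewrite (det_core (Dcc 1) Bcc) zb1. Qed.

Let cofD1 : cof (D 1) = \det (core B (D 1) c (lift c)) +
  adjform (mxsub (fun=> c) (lift c) (D 1))
  (core B (D 1) c (lift c)) (mxsub (lift c) (fun=> c) B - const_mx 1).
Proof.
rewrite [cof _](adjform_core (Dcc 1) Bcc) mxE mul1r scale1r -adjformNr opprB.
by congr (_ + adjform _ _ (_ - _)); apply/matrixP=> i j; rewrite !mxE.
Qed.

(** For [a = 1], the same form occurs in [detD1] and [cofD1] with opposite signs, so the determinant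
    of the core is their sum, which is [\det B]. The exponent is the size of the core. *)
Lemma det_block_core a :
  \det (core B (D a) c (lift c)) = a ^+ q.-1 * \det B.
Proof. by rewrite coreZ detZ detB detD1 cofD1 addrC addrK. Qed.

(** The row contributes one factor [a], and the adjugate of the core, whose size is [q.-1], the
    others. *)
Lemma adjform_block_core a :
  adjform (mxsub (fun=> c) (lift c) (D a)) (core B (D a) c (lift c))
    (mxsub (lift c) (fun=> c) B - const_mx 1) =
  a ^+ q.-1 * (cof B - \det B).
Proof.
set wd := mxsub (fun _ : 'I_1 => c) (lift c) (D a).
set z := mxsub (lift c) (fun _ : 'I_1 => c) B - _.
have cofBE : cof B - \det B =
    adjform (mxsub (fun=> c) (lift c) (D 1)) (core B (D 1) c (lift c)) z.
  by rewrite detB cofB opprD addrCA subrr addr0 detD1 opprK.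
have wdE : wd = a *: mxsub (fun=> c) (lift c) (D 1).
  by apply/matrixP=> i j; rewrite !mxE; ring.
rewrite cofBE wdE coreZ adjformZl {cofBE wdE wd} /adjform adjZ -!scalemxAr
  -!scalemxAl mxE mulrA -exprS.
(* For a block with one vertex the core is empty, the exponent count fails by one, and both sides
   are zero. *)
move: z (core _ _ _ _) (mxsub _ _ _); case: q.-1 => [|r] z C w //.
by rewrite (thinmx0 w) !mul0mx !mxE !mulr0.
Qed.

End Block.
End Reindexing.

(** * Attaching a block *)

Section RingFormulas.

Context (R : comNzRingType).

Section BlockData.

Context (E : finType) (p : E -> nat).
Context (a : E -> R) (m m' : forall e, 'I_(p e) -> R).

Definition block_kappa (e : E) : R :=
  a e ^+ (p e).-1 * \det (block_mul_mx (@m e) (@m' e)).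

(** For a graph consisting of the block [e] alone, this is the difference between the sum of all
    cofactors and [kappa]. *)
Definition block_excess (e : E) : R :=
  a e ^+ (p e).-1 *
  (cof (block_mul_mx (@m e) (@m' e)) - \det (block_mul_mx (@m e) (@m' e))).

End BlockData.

(** This has the shape of the derivative of a product: it is the product of all [K e] times the sum
    of the [Q e / K e], written without division. *)
Definition leibniz_sum (E : finType) (K Q : E -> R) (F : {set E}) : R :=
  \sum_(e in F) Q e * \prod_(f in F :\ e) K f.

Lemma leibniz_sum0 (E : finType) (K Q : E -> R) : leibniz_sum K Q set0 = 0.
Proof. by rewrite /leibniz_sum big_set0. Qed.

Lemma leibniz_sumU1 (E : finType) (K Q : E -> R) (F : {set E}) e : e \notin F ->
  leibniz_sum K Q (e |: F) =
    Q e * (\prod_(f in F) K f) + K e * leibniz_sum K Q F.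
Proof.
move=> eF; rewrite /leibniz_sum big_setU1 //= setU1K //; congr (_ + _).
rewrite big_distrr /=; apply: eq_bigr => f fF.
have ef : e != f by apply: contraNneq eF => ->.
have -> : (e |: F) :\ f = e |: (F :\ f).
  by apply/setP=> x; rewrite !inE; have [->|] := eqVneq x e; rewrite ?ef.
rewrite big_setU1 ?inE ?(negbTE eF) ?andbF //=.
by rewrite mulrCA.
Qed.

End RingFormulas.

Section AttachBlock.

Context (R : comNzRingType) (n : nat) (E : finType) (p : E -> nat).
Context (node : forall e : E, 'I_(p e) -> 'I_n) (M D : 'M[R]_n).
Context (a : E -> R) (m m' : forall e, 'I_(p e) -> R).
Hypothesis Mblock : forall e (v w : 'I_(p e)),
  M (node v) (node w) = block_mul_mx (@m e) (@m' e) v w.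
Hypothesis Dblock : forall e (v w : 'I_(p e)),
  D (node v) (node w) = block_addmul_mx (a e) (@m e) (@m' e) v w.

Local Notation K := (block_kappa a m m').
Local Notation Q := (block_excess a m m').

(** The third clause gives [kappa] from every listed vertex, since the next block may be attached at
    any of them. *)
Definition block_formulas k (f : 'I_k -> 'I_n) (F : {set E}) : Prop :=
  [/\ \det (mxsub f f D) = - leibniz_sum K (fun e => a e * Q e) F,
      cof (mxsub f f D) = \prod_(e in F) K e + leibniz_sum K Q F &
      forall c, adjform ones (mxsub f f D) (mxsub f (fun=> f c) M) =
                \prod_(e in F) K e].

(** The core of the attached part depends only on the block [e] and its vertex [vc], so its
    determinant is [K e] and its form is governed by [Q e]; the attachment recurrences then become
    product rules. *)
Lemma block_formulas_attach k (f : 'I_k -> 'I_n) (F : {set E}) e (c : 'I_k) (vc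
  : 'I_(p e)) :
  e \notin F -> f c = node vc ->
  (forall i (v : 'I_(p e)), M (f i) (node v) =
    M (f i) (f c) * M (f c) (node v) /\
     D (f i) (node v) = D (f i) (f c) + M (f i) (f c) * D (f c) (node v)) ->
  (forall i (v : 'I_(p e)), M (node v) (f i) =
    M (node v) (f c) * M (f c) (f i) /\
     D (node v) (f i) = D (node v) (f c) + M (node v) (f c) * D (f c) (f i)) ->
  block_formulas f F ->
  block_formulas (glue f (@node e \o lift vc)) (e |: F).
Proof.
move=> eF fc out into [detF cofF kapF].
pose h := @node e \o lift vc; pose B := block_mul_mx (@m e) (@m' e).
have Bcc : B vc vc = 1 by rewrite mxE eqxx.
have Mcc : M (f c) (f c) = 1 by rewrite fc Mblock.
have Dcc : D (f c) (f c) = 0 by rewrite fc Dblock !mxE eqxx subrr mulr0.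
pose zb := mxsub h (fun _ : 'I_1 => f c) M.
pose wd := mxsub (fun _ : 'I_1 => f c) h D.
pose db := mxsub h (fun _ : 'I_1 => f c) D.
pose De := a e *: (B - const_mx 1).
have zbE : zb = mxsub (lift vc) (fun _ : 'I_1 => vc) B.
  by apply/matrixP=> i j; rewrite mxE fc Mblock [RHS]mxE.
have wdE : wd = mxsub (fun _ : 'I_1 => vc) (lift vc) De.
  by apply/matrixP=> i j; rewrite mxE fc Dblock [RHS]mxE.
have dbE0 : db = mxsub (lift vc) (fun _ : 'I_1 => vc) De.
  by apply/matrixP=> i j; rewrite mxE fc Dblock [RHS]mxE.
have dbE : db = a e *: (zb - const_mx 1).
  by rewrite dbE0 zbE; apply/matrixP=> i j; rewrite !mxE.
have coreE : core M D (f c) h = core B De vc (lift vc).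
  rewrite /core -/zb -/wd -/db zbE wdE dbE0; congr attach_core.
  by apply/matrixP=> i j; rewrite mxE Dblock [RHS]mxE.
have detC : \det (core M D (f c) h) = K e by rewrite coreE (det_block_core Bcc).
have adjC : adjform wd (core M D (f c) h) (zb - const_mx 1) = Q e.
  by rewrite coreE wdE zbE (adjform_block_core Bcc).
have subE := mxsub_glue_attach (fun i v => (out i (lift vc v)).2)
  (fun v i => (into i (lift vc v)).2).
rewrite -/h -/zb -/wd -/db in subE.
have A0 : mxsub f f D c c = 0 by rewrite mxE.
have m1 : mxsub f (fun _ : 'I_1 => f c) M c 0 = 1 by rewrite mxE.
have kapE u : adjform ones (mxsub (glue f h) (glue f h) D) u =
  adjform ones (mxsub f f D) (usubmx u) * K e -
  (\prod_(e in F) K e) * adjform wd (core M D (f c) h)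
    (dsubmx u - usubmx u c 0 *: zb).
  by rewrite -{1}[u]vsubmxK subE (adjform_attach _ _ _ _ A0 m1) kapF detC.
split.
- rewrite subE (det_attach _ _ _ _ A0 m1) kapF -/(core M D (f c) h) detC dbE.
  by rewrite adjformZr adjC detF leibniz_sumU1 //; ring.
- rewrite [cof _]kapE leibniz_sumU1 // big_setU1 //=.
  have -> : usubmx (const_mx 1 : 'cV[R]_(k + (p e).-1)) = const_mx 1.
    by apply/matrixP=> i j; rewrite !mxE.
  have -> : dsubmx (const_mx 1 : 'cV[R]_(k + (p e).-1)) = const_mx 1.
    by apply/matrixP=> i j; rewrite !mxE.
  have -> : const_mx 1 - (const_mx 1 : 'cV[R]_k) c 0 *: zb =
    - (zb - const_mx 1).
    by rewrite mxE scale1r opprB.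
  rewrite adjformNr adjC [adjform _ _ _]cofF; ring.
- move=> c'; rewrite kapE big_setU1 //= mxsub_gluel col_mxKu col_mxKd.
  (* Seen from an old vertex, the correction vanishes because [M] is multiplicative through
     [f c]. *)
  rewrite [X in _ - X *: _]mxE; case: (glueP f h c') => [[i ->]|[v ->]].
    rewrite kapF.
    have -> : mxsub h (fun=> f i) M - M (f c) (f i) *: zb = 0.
      by apply/matrixP=> j l; rewrite !mxE (into i (lift vc j)).1; ring.
    by rewrite adjform0r; ring.
  have -> : mxsub f (fun _ : 'I_1 => h v) M =
    M (f c) (h v) *: mxsub f (fun=> f c) M.
    by apply/matrixP=> j l; rewrite !mxE (out j (lift vc v)).1; ring.
  have wdE1 : wd = a e *: (mxsub (fun _ : 'I_1 => f c) h M - const_mx 1).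
    by apply/matrixP=> j l; rewrite !mxE fc Dblock Mblock !mxE.
  rewrite {1}wdE1 adjformZl -adjformZr.
  (* Seen from a new vertex, the correction, scaled by the [a e] taken out of [wd], is a column of
     the core, so its form is the determinant of the core times an entry of the row. *)
  have -> : a e *: (mxsub h (fun=> h v) M - M (f c) (h v) *: zb) =
      core M D (f c) h *m delta_mx v 0.
    rewrite -colE; apply/matrixP=> j l; rewrite !mxE !big_ord1 !mxE fc.
    by rewrite !Dblock !Mblock !mxE; ring.
  rewrite adjform_mul detC -colE !mxE adjformZr kapF; ring.
Qed.

End AttachBlock.

(** * Explicit formulas for one block *)

Section FieldFormulas.

Lemma sum_ltn_symmetrize (V : zmodType) q (G : 'I_q -> 'I_q -> V) :
  (forall v, G v v = 0) ->
  \sum_(v < q) \sum_(w < q | (v < w)%N) (G v w + G w v) =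
  \sum_(v < q) \sum_(w < q) G v w.
Proof.
move=> G0; under eq_bigr do rewrite big_split; rewrite big_split /=.
rewrite [X in _ + X](exchange_big_dep predT) //= -big_split /=.
apply: eq_bigr => v _; rewrite [RHS](bigID (fun w : 'I_q => (v < w)%N)) /=.
congr (_ + _); rewrite [RHS](bigID (fun w : 'I_q => (w < v)%N)) /=.
rewrite [X in _ = _ + X]big1 ?addr0.
  by apply: eq_bigl => w; case: ltngtP.
move=> w; rewrite -!leqNgt => /anti_leq/val_inj->; exact: G0.
Qed.

Context (F : fieldType).

Section OneBlock.

Context (q : nat) (m m' : 'I_q -> F).
Hypothesis nz : forall v, 1 - m v * m' v != 0.

Let y v := (1 - m v * m' v)^-1.
Let s := 1 + \sum_v m v * m' v * y v.
Let pi := \prod_v (1 - m v * m' v).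
Let B := block_mul_mx m m'.

Let yK v : y v - m v * m' v * y v = 1.
Proof. by rewrite -{1}[y v]mul1r -mulrBl mulfV. Qed.

Let B_mul (z : 'cV_q) v :
  (B *m z) v 0 = (1 - m v * m' v) * z v 0 + m v * \sum_w m' w * z w 0.
Proof.
rewrite !mxE (bigD1 v) //= mxE eqxx mul1r [in RHS](bigD1 v) //=.
rewrite (eq_bigr (fun w => m v * (m' w * z w 0))) => [|w wv].
  by rewrite -mulr_sumr; ring.
by rewrite mxE eq_sym (negbTE wv) mulrA.
Qed.

Lemma det_block_mul_mx : \det (block_mul_mx m m') =
  (\prod_v (1 - m v * m' v)) * (1 + \sum_v m v * m' v / (1 - m v * m' v)).
Proof.
rewrite -/s -/B; pose Dl := diag_mx (\row_v (1 - m v * m' v)).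
have -> : B = Dl + (\col_v m v) *m (\row_v m' v).
  apply/matrixP=> i j; rewrite !mxE big_ord1 !mxE.
  by have [->|_] := eqVneq i j; rewrite ?mulr1n ?mulr0n ?subrK ?add0r.
have -> : \col_v m v = Dl *m (\col_v (m v * y v)).
  apply/matrixP=> i j; rewrite mul_diag_mx !mxE mulrCA mulfV ?mulr1 //.
rewrite det_rank1 adjform_mul det_diag mulrDr mulr1 /pi.
have -> : \prod_i (\row_v (1 - m v * m' v)) 0 i = \prod_i (1 - m i * m' i).
  by apply: eq_bigr => i _; rewrite mxE.
congr (_ + _ * _); rewrite mxE; apply: eq_bigr => i _; rewrite !mxE; ring.
Qed.

(** This is an identity of Lagrange type: the sum over unordered pairs is extended to all ordered
    pairs, where it factors. *)
Let pairs : q%:R - 1 + \sum_(v < q) \sum_(w < q | (v < w)%N)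
     (m v - m w) * (m' v - m' w) / ((1 - m v * m' v) * (1 - m w * m' w)) =
  s * (\sum_v y v - 1) - (\sum_v m v * y v) * (\sum_v m' v * y v).
Proof.
(* [G] vanishes on the diagonal, and [G v w + G w v] is the summand of the pair [v], [w]. *)
pose G v w := (m w * m' w - m v * m' w) * (y v * y w).
rewrite (eq_bigr (fun v : 'I_q => \sum_(w < q | (v < w)%N) (G v w + G w v)));
  last first.
  by move=> v _; apply: eq_bigr => w _; rewrite invfM -/(y v) -/(y w) /G; ring.
rewrite sum_ltn_symmetrize => [|v]; last by rewrite /G subrr mul0r.
have -> : \sum_(v < q) \sum_(w < q) G v w =
    (\sum_v y v) * (\sum_v m v * m' v * y v) -
    (\sum_v m v * y v) * (\sum_v m' v * y v).
  rewrite !big_distrl -sumrB; apply: eq_bigr => v _.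
  by rewrite !big_distrr -sumrB; apply: eq_bigr => w _; rewrite /G /=; ring.
have -> : q%:R = \sum_v y v - \sum_v m v * m' v * y v.
  by rewrite -sumrB (eq_bigr _ (fun v _ => yK v)) sumr_const card_ord.
rewrite /s; ring.
Qed.

Lemma excess_block_mul_mx : 1 + \sum_v m v * m' v / (1 - m v * m' v) != 0 ->
  cof (block_mul_mx m m') - \det (block_mul_mx m m') =
  (\prod_v (1 - m v * m' v)) *
  (q%:R - 1 + \sum_(v < q) \sum_(w < q | (v < w)%N)
     (m v - m w) * (m' v - m' w) / ((1 - m v * m' v) * (1 - m w * m' w))).
Proof.
rewrite pairs -/s -/B -/pi.
move=> s0; pose sg := \sum_v m' v * y v.
(* By the Sherman-Morrison formula this is the solution of [B *m z = const_mx 1]; hence [cof B] is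
   [\det B] times the sum of the entries of [z]. *)
pose z : 'cV[F]_q := \col_v (y v - m v * y v * (sg / s)).
have zE : \sum_w m' w * z w 0 = sg / s.
  transitivity (sg - (\sum_v m v * m' v * y v) * (sg / s)).
    rewrite {1}/sg big_distrl -sumrB /=; apply: eq_bigr => v _.
    by rewrite mxE; ring.
  have -> : \sum_v m v * m' v * y v = s - 1 by rewrite /s addrAC subrr add0r.
  by field.
have Bz : B *m z = const_mx 1.
  apply/matrixP=> v j; rewrite (ord1 j) B_mul zE !mxE.
  have yV : (1 - m v * m' v) * y v = 1 by rewrite mulfV.
  transitivity ((1 - m v * m' v) * y v * (1 - m v * (sg / s)) + m v * (sg / s)).
    by ring.
  by rewrite yV; ring.
rewrite [cof B]/cof -/(adjform _ _ _) -Bz adjform_mul det_block_mul_mx -/pi -/s.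
have -> : ((const_mx 1 : 'rV_q) *m z) 0 0 =
  \sum_v y v - (\sum_v m v * y v) * (sg / s).
  rewrite mxE big_distrl -sumrB; apply: eq_bigr => v _.
  by rewrite !mxE mul1r.
by rewrite -/sg; field.
Qed.

End OneBlock.

Context (E : finType) (p : E -> nat).
Context (a : E -> F) (m m' : forall e, 'I_(p e) -> F).
Hypothesis nz : forall e (v : 'I_(p e)), 1 - m v * m' v != 0.

Hypothesis nzs : forall e, one_plus_sum_d m m' e != 0.

Local Notation K := (block_kappa a m m').
Local Notation Q := (block_excess a m m').

Let sE e : one_plus_sum_d m m' e =
  1 + \sum_(v < p e) m v * m' v / (1 - m v * m' v).
Proof.
by rewrite /one_plus_sum_d mxE; congr (_ + _); apply: eq_bigr => v _;
  rewrite !mxE mul1r.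
Qed.

Let KE e : K e = a e ^+ (p e).-1 * one_plus_sum_d m m' e *
           \prod_(v < p e) (1 - m v * m' v).
Proof. by rewrite sE /block_kappa (det_block_mul_mx (@nz e)) [in RHS]mulrAC
  mulrA. Qed.

Let QE e : Q e = K e / one_plus_sum_d m m' e * pair_sum m m' e.
Proof.
have s0 := nzs e; rewrite KE /block_excess excess_block_mul_mx -?sE //.
by rewrite -/(pair_sum m m' e); field.
Qed.

Lemma kappa_rhsE : kappa_rhs a m m' = \prod_e K e.
Proof. by apply: eq_bigr => e _; rewrite KE. Qed.

Let leibnizE (c : E -> F) :
  leibniz_sum K (fun e => c e * Q e) setT =
  (\prod_e K e) * \sum_e c e / one_plus_sum_d m m' e * pair_sum m m' e.
Proof.
rewrite mulr_sumr; apply: eq_big => [e|e _]; first by rewrite inE.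
have -> : \prod_f K f = K e * \prod_(f in setT :\ e) K f.
  by rewrite (bigD1 e) //=; congr (_ * _); apply: eq_bigl => f;
    rewrite !inE andbT.
by rewrite QE; ring.
Qed.

Lemma det_rhsE : det_rhs a m m' = - leibniz_sum K (fun e => a e * Q e) setT.
Proof.
rewrite leibnizE /det_rhs kappa_rhsE -mulrN -sumrN; congr (_ * _).
by apply: eq_bigr => e _; rewrite !mulNr.
Qed.

Lemma cof_rhsE : cof_rhs a m m' = \prod_e K e + leibniz_sum K Q setT.
Proof.
have -> : leibniz_sum K Q setT = leibniz_sum K (fun e => 1 * Q e) setT.
  by apply: eq_bigr => e _; rewrite mul1r.
by rewrite leibnizE /cof_rhs kappa_rhsE mulrDr mulr1.
Qed.

End FieldFormulas.

(** * Strong blocks of a hypertree *)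

Section Blocks.

Context (n : nat) (g : rel 'I_n).
Implicit Types (S T B : {set 'I_n}) (c i j s t u v x y : 'I_n).

Definition adjacent u v := g u v || g v u.

Lemma joined_in_sym S i j : joined_in g S i j = joined_in g S j i.
Proof.
by apply: sym_connect_sym => u v; rewrite andbCA orbC.
Qed.

Lemma joined_inS S T i j : S \subset T -> joined_in g S i j -> joined_in g T i
  j.
Proof.
move=> /subsetP sST; apply: connect_sub => u v /and3P[uS vS uv].
by apply: connect1; rewrite !sST.
Qed.

Lemma joined_in_edge S i j : i \in S -> j \in S -> adjacent i j -> joined_in g
  S i j.
Proof. by move=> iS jS ij; apply: connect1; rewrite iS jS. Qed.

Lemma connected_onP S :
  reflect {in S &, forall i j, joined_in g S i j} (connected_on g S).
Proof.
apply: (iffP forall_inP) => [H i j iS jS|H i iS];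
  last by apply/forall_inP => j /(H i j iS).
exact: (forall_inP (H i iS)).
Qed.

Lemma connected_onU S T x : x \in S -> x \in T ->
  connected_on g S -> connected_on g T -> connected_on g (S :|: T).
Proof.
move=> xS xT /connected_onP cS /connected_onP cT.
have to_x i : i \in S :|: T -> joined_in g (S :|: T) i x.
  rewrite inE => /orP[iS|iT].
    exact: joined_inS (subsetUl _ _) (cS _ _ iS xS).
  exact: joined_inS (subsetUr _ _) (cT _ _ iT xT).
apply/connected_onP => i j /to_x ix /to_x jx.
by apply: connect_trans ix _; rewrite [connect _ _ _]joined_in_sym.
Qed.

Lemma path_connected_on x q : path adjacent x q -> connected_on g [set u in x
  :: q].
Proof.
move=> xq; have from_x j : j \in x :: q -> joined_in g [set u in x :: q] x j.
  elim: q x xq => [|y q IH] x /=; first by rewrite inE => _ /eqP->;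
    exact: connect0.
  case/andP=> xy yq; rewrite inE => /predU1P[->|jq]; first exact: connect0.
  apply: connect_trans (_ : joined_in _ _ x y) _.
    by apply: joined_in_edge; rewrite // !inE eqxx ?orbT.
  apply: joined_inS (IH _ yq jq); apply/subsetP=> u.
  by rewrite !inE => ->; rewrite orbT.
apply/connected_onP => i j; rewrite !inE => /from_x xi /from_x xj.
by apply: connect_trans _ xj; rewrite [connect _ _ _]joined_in_sym.
Qed.

Definition biconnected_on S :=
  connected_on g S && [forall v, ~~ cut_vertex g S v].

Lemma biconnected_onP S : reflect
  (connected_on g S /\ forall v, connected_on g (S :\ v)) (biconnected_on S).
Proof.
apply: (iffP andP) => -[cS cut]; split=> //.
  move=> v; have [vS|vS] := boolP (v \in S).
    by have := forallP cut v; rewrite /cut_vertex vS negbK.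
  by rewrite (setDidPl _) // disjoint_sym disjoints1.
by apply/forallP => v; rewrite negb_and cut orbT.
Qed.

(** Whichever vertex is removed, [x] or [y] survives as a common vertex of the two parts. *)
Lemma biconnected_onU S T x y : x != y -> x \in S -> x \in T -> y \in S -> y
  \in T ->
  biconnected_on S -> biconnected_on T -> biconnected_on (S :|: T).
Proof.
move=> xy xS xT yS yT /biconnected_onP[cS dS] /biconnected_onP[cT dT].
apply/biconnected_onP; split=> [|v]; first exact: connected_onU xS xT cS cT.
rewrite setDUl; have [vx|vx] := eqVneq v x.
  by apply: (connected_onU (x := y)); rewrite // !inE ?yS ?yT vx eq_sym xy.
by apply: (connected_onU (x := x)); rewrite // !inE ?xS ?xT eq_sym vx.
Qed.

(** Rotating the cycle to start at the removed vertex shows that a path is left. *)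
Lemma biconnected_on_ucycle q : ucycle adjacent q -> biconnected_on [set u in
  q].
Proof.
case/andP=> cq uq; apply/biconnected_onP; split=> [|v].
  case: q cq {uq} => [|x q] /=.
    by move=> _; apply/connected_onP => i j; rewrite inE.
  by rewrite rcons_path => /andP[/path_connected_on].
have [vq|vq] := boolP (v \in q); last first.
  rewrite (setDidPl _); last by rewrite disjoint_sym disjoints1 inE.
  case: q cq {uq vq} => [|x q] /=.
    by move=> _; apply/connected_onP => i j; rewrite inE.
  by rewrite rcons_path => /andP[/path_connected_on].
have [k r rotE] := rot_to vq.
have -> : [set u in q] :\ v = [set u in r].
  apply/setP=> u; rewrite !inE -(mem_rot k) rotE inE.
  have := uq; rewrite -(rot_uniq k) rotE /= => /andP[vr _].
  by have [->|] := eqVneq u v; rewrite ?(negbTE vr).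
move: cq; rewrite -(rot_cycle k) rotE.
case: r {rotE} => [|y r] /=; first by move=> _; apply/connected_onP => i j;
  rewrite inE.
by rewrite rcons_path => /and3P[_ /path_connected_on].
Qed.

Lemma strong_block_cover S : biconnected_on S ->
  exists2 B, strong_block g B & S \subset B.
Proof. by case/maxset_exists => B; exists B. Qed.

Lemma strong_block_absorb B S x y : strong_block g B -> biconnected_on S ->
  x != y -> x \in B -> y \in B -> x \in S -> y \in S -> S \subset B.
Proof.
case/maxsetP => bB maxB bS xy xB yB xS yS.
have bU := biconnected_onU xy xB xS yB yS bB bS.
by rewrite -(maxB _ bU (subsetUl B S)) subsetUr.
Qed.

Lemma strong_block_eq B1 B2 x y : strong_block g B1 -> strong_block g B2 ->
  x != y -> x \in B1 -> y \in B1 -> x \in B2 -> y \in B2 -> B1 = B2.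
Proof.
move=> b1 b2 xy x1 y1 x2 y2; apply/eqP; rewrite eqEsubset.
by rewrite (strong_block_absorb b2 (proj1 (maxsetP b1)) xy)
  ?(strong_block_absorb b1 (proj1 (maxsetP b2)) xy).
Qed.

Lemma strong_block_vertex x : exists2 B, strong_block g B & x \in B.
Proof.
have : biconnected_on [set x].
  apply/biconnected_onP; split=> [|v]; apply/connected_onP => i j; rewrite !inE.
    by move=> /eqP-> /eqP->; exact: connect0.
  by move=> /andP[_ /eqP->] /andP[_ /eqP->]; exact: connect0.
by case/strong_block_cover => B bB; rewrite sub1set; exists B.
Qed.

Context (hg : hypertree g).

Lemma strong_block_edge x y : adjacent x y ->
  exists B, [/\ strong_block g B, x \in B & y \in B].
Proof.
case: hg => irr _ _ xy.
have : biconnected_on [set u in [:: x; y]].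
  have yx : adjacent y x by rewrite /adjacent orbC.
  (* An edge traversed back and forth counts as a cycle of length two. *)
  apply: biconnected_on_ucycle; rewrite /ucycle /= xy yx !inE !andbT /=.
  by apply: contraTneq xy => ->; rewrite /adjacent irr.
case/strong_block_cover => B bB /subsetP sB; exists B; split=> //; apply: sB;
  by rewrite !inE eqxx ?orbT.
Qed.

Lemma strong_block_clique B x y :
  strong_block g B -> x \in B -> y \in B -> x != y -> adjacent x y.
Proof. by case: hg => _ _ cl bB xB yB xy; rewrite /adjacent (cl B). Qed.

(* Closing up a simple path from [s] to [t] that avoids [c] gives a cycle. *)
Lemma joined_same_block B1 B2 c s t : strong_block g B1 -> strong_block g B2 ->
  c \in B1 -> c \in B2 -> s \in B1 -> t \in B2 -> s != c -> t != c ->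
  joined_in g [set~ c] s t -> B1 = B2.
Proof.
move=> b1 b2 c1 c2 s1 t2 sc tc /connectP[q sq tE].
case/shortenP: sq tE => {}q sq uq _ tE.
have hq : path adjacent s q by apply: sub_path sq => u v /and3P[].
have cq : c \notin q.
  elim: q s sq {s1 sc uq hq tE} => //= v q IH s /andP[/and3P[_ vc _] /IH].
  by rewrite inE negb_or => ->; rewrite eq_sym; move: vc; rewrite !inE => ->.
have bU : biconnected_on [set u in c :: s :: q].
  apply: biconnected_on_ucycle;
    rewrite /ucycle cons_uniq uq inE negb_or cq eq_sym sc.
  rewrite !andbT /= rcons_path hq -tE.
  by rewrite (strong_block_clique b1) 1?eq_sym // (strong_block_clique b2).
have cU : c \in [set u in c :: s :: q] by rewrite !inE eqxx.
have sU : s \in [set u in c :: s :: q] by rewrite !inE eqxx orbT.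
have tU : t \in [set u in c :: s :: q] by rewrite inE in_cons tE mem_last orbT.
(* The cycle shares [c] and [t] with [B2], hence lies in it; so [B1] and [B2] share [s] and [c]. *)
have U2 := strong_block_absorb b2 bU tc t2 c2 tU cU.
exact: strong_block_eq b1 b2 sc s1 c1 (subsetP U2 _ sU) c2.
Qed.

End Blocks.

(** * Building a hypertree block by block *)

Section HypertreeInduction.

Context (n : nat) (g : rel 'I_n) (E : finType) (p : E -> nat).
Context (node : forall e : E, 'I_(p e) -> 'I_n).
Hypotheses (hg : hypertree g) (hnode : block_labelling g node).

Let blk e := [set node v | v : 'I_(p e)].

Let blkP e : strong_block g (blk e).
Proof. by case: hnode => _ _ H; apply/H; exists e. Qed.

Let blk_ex B : strong_block g B -> exists e, B = blk e.
Proof. by case: hnode => _ _ H /H. Qed.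

(* The second condition: every vertex of [S] is left towards the rest of [S]
   through a block in [F]. *)
Let built (S : {set 'I_n}) (F : {set E}) :=
  [/\ connected_on g S,
      {in S &, forall c j, c != j -> exists e s,
        [/\ e \in F, c \in blk e, s \in blk e, s != c & joined_in g [set~ c] s
          j]} &
      forall e, e \in F -> blk e \subset S].

(** A connection would prolong the way from [c] to [i] through a block of [F] to one reaching the
    block [e], which would then coincide with that block. *)
Let built_separated S F e c i j : built S F -> e \notin F ->
  c \in S -> c \in blk e -> i \in S -> j \in blk e -> i != c -> j != c ->
  ~~ joined_in g [set~ c] i j.
Proof.
case=> _ st _ eF cS ce iS je ic jc; apply/negP => ij.
rewrite eq_sym in ic; have [f [s [fF cf sf sc si]]] := st _ _ cS iS ic.
have := joined_same_block hg (blkP f) (blkP e) cf ce sf je sc jc (connect_trans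
  si ij).
by case: hnode => _ inj _ /inj fe; move: eF; rewrite -fe fF.
Qed.

Let built_step S F e c : built S F -> c \in S -> c \in blk e ->
  built (S :|: blk e) (e |: F).
Proof.
case=> cS st sub cSc ce; have [cB _] :=
  biconnected_onP _ _ (proj1 (maxsetP (blkP e))).
split=> [||f]; first exact: connected_onU cSc ce cS cB.
  move=> x j; rewrite !in_setU => xS jS xj.
  have [xe|xe] := boolP (x \in blk e).
    have [je|je] := boolP (j \in blk e).
      by exists e, j; rewrite setU11 eq_sym; split=> //; exact: connect0.
    rewrite (negbTE je) orbF in jS.
    have [xS'|xS'] := boolP (x \in S).
      have [f [s [fF xf sf sx sj]]] := st _ _ xS' jS xj.
      by exists f, s; rewrite in_setU fF orbT.
    (* From a new vertex the old ones are reached through [e] itself, by way of [c]. *)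
    exists e, c; rewrite setU11; split=> //;
      first by apply: contraNneq xS' => <-.
    apply: joined_inS (connected_onP _ _ cS _ _ cSc jS).
    by apply/subsetP => u uS; rewrite !inE; apply: contraNneq xS' => <-.
  rewrite (negbTE xe) orbF in xS.
  have [jS'|jS'] := boolP (j \in S).
    have [f [s [fF xf sf sx sj]]] := st _ _ xS jS' xj.
    by exists f, s; rewrite in_setU fF orbT.
  rewrite (negbTE jS') /= in jS.
  (* From an old vertex outside the block, a new one is reached through [c] and then one edge of the
     clique. *)
  have xc : x != c by apply: contraNneq xe => ->.
  have [f [s [fF xf sf sx sc]]] := st _ _ xS cSc xc.
  exists f, s; rewrite in_setU fF orbT; split=> //.
  have jc : c != j by apply: contraNneq jS' => <-.
  have cj : joined_in g [set~ x] c j.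
    apply: (joined_in_edge _ _ (strong_block_clique hg (blkP e) ce jS jc)).
      by rewrite !inE eq_sym.
    by rewrite !inE; apply: contraNneq xe => <-.
  exact: connect_trans sc cj.
rewrite in_setU1 => /predU1P[->|/sub]; first exact: subsetUr.
by move=> /subset_trans; apply; exact: subsetUl.
Qed.

(** If [S] is not everything, strong connectedness gives an edge leaving [S], and its block is not
    in [F]. Otherwise any block outside [F] will do, as happens for the one-vertex graph. *)
Let built_next S F : S != set0 -> built S F -> F != setT ->
  exists e c, [/\ e \notin F, c \in S & c \in blk e].
Proof.
case/set0Pn => v0 v0S [_ _ sub] FT.
have [ST|] := eqVneq S setT.
  have [e eF] : exists e, e \notin F.
    apply/existsP; rewrite -negb_forall; apply: contraNN FT => /forallP FT.
    by apply/eqP/setP => e; rewrite FT inE.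
  suff [c ce] : exists c, c \in blk e by exists e, c; rewrite ST inE.
  (* The empty set is not a strong block, since [v0] lies in one and maximality would fail. *)
  apply/set0Pn/negP => /eqP e0; have [B bB vB] := strong_block_vertex g v0.
  have /maxsetP[_ max0] : strong_block g set0 by rewrite -e0.
  have [bBB _] := maxsetP bB.
  by move: vB; rewrite (max0 _ bBB (sub0set _)) inE.
rewrite -subTset => /subsetPn[w _ wS].
have [x [y [xS yS xy]]] : exists x y, [/\ x \in S, y \notin S & g x y || g y x].
  have [/existsP[x /existsP[y /andP[xy]]]|noE] :=
      boolP [exists x, exists y, g x y && ((x \in S) != (y \in S))].
    have [xS yS|xS yS] := boolP (x \in S); first by exists x, y; rewrite xy yS.
    by exists y, x; rewrite xy orbT xS; split=> //;
      apply: contraNT yS => /negbTE->.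
  have clS : closed g S.
    move=> x y xy; apply/eqP; apply: contraNT noE => xyS.
    by apply/existsP; exists x; apply/existsP; exists y; rewrite xy.
  by case: hg => _ conn _; move: wS;
    rewrite -(closed_connect clS (conn v0 w)) v0S.
have [B [bB xB yB]] := strong_block_edge hg xy.
have [e Be] := blk_ex bB; rewrite Be in xB yB; exists e, x; split=> //.
by apply: contraNN yS => /sub/subsetP; apply.
Qed.

Lemma hypertree_ind (P : forall k, ('I_k -> 'I_n) -> {set E} -> Prop) (v0 :
  'I_n) :
  P 1 (fun=> v0) set0 ->
  (forall k (f : 'I_k -> 'I_n) (F : {set E}) e (c : 'I_k) (vc : 'I_(p e)),
     e \notin F -> f c = node vc ->
     (forall i (v : 'I_(p e)), f i != f c -> v != vc ->
        ~ in_common_block g (f i) (node v) /\ separates g (f c) (f i) (node v))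
          ->
     P k f F -> P _ (glue f (@node e \o lift vc)) (e |: F)) ->
  exists k (f : 'I_k -> 'I_n), [/\ injective f, k = n & P k f setT].
Proof.
move=> P0 PS; pose img k (f : 'I_k -> 'I_n) := [set f i | i : 'I_k].
(* [N] counts the blocks still to be attached. *)
suff loop N k (f : 'I_k -> 'I_n) F : #|~: F| = N -> injective f ->
    img k f != set0 -> built (img k f) F -> P k f F ->
    exists k (f : 'I_k -> 'I_n), [/\ injective f, k = n & P k f setT].
  have img1 : img 1 (fun=> v0) = [set v0].
    by apply/setP=> u; rewrite inE; apply/imsetP/eqP => [[]|->] //; exists ord0.
  apply: (loop _ 1 _ set0 erefl _ _ _ P0); rewrite ?img1.
  - by move=> i j _; rewrite (ord1 i) (ord1 j).
  - by apply/set0Pn; exists v0; rewrite inE.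
  - split=> [|c j|e]; last by rewrite inE.
      by apply/connected_onP => i j; rewrite !inE => /eqP-> /eqP->;
        exact: connect0.
    by rewrite !inE => /eqP-> /eqP->; rewrite eqxx.
elim: N k f F => [|N IH] k f F FN injf img0 bF Pf.
  have FT : F = setT by rewrite -[F]setCK (cards0_eq FN) setC0.
  exists k, f; rewrite -FT; split=> //.
  have : img k f = setT.
    apply/setP=> x; rewrite inE; have [B bB xB] := strong_block_vertex g x.
    have [e Be] := blk_ex bB; case: bF => _ _ /(_ e);
      rewrite FT inE => /(_ isT)/subsetP.
    by apply; rewrite -Be.
  by move/(congr1 (fun X : {set _} => #|X|));
    rewrite cardsT card_ord card_imset // card_ord.
have FT : F != setT by apply: contra_eqN FN => /eqP->; rewrite setCT cards0.
have [e [_ [eF /imsetP[c _ ->] /imsetP[vc _ fc]]]] := built_next img0 bF FT.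
have fS i : f i \in img k f by exact: imset_f.
have ne (v : 'I_(p e)) : node v \in blk e by exact: imset_f.
have inj_node : injective (@node e) by case: hnode => H _ _.
have fce : f c \in blk e by rewrite fc.
have sep i (v : 'I_(p e)) : f i != f c -> v != vc ->
    ~~ joined_in g [set~ f c] (f i) (node v).
  move=> ic vvc; apply: built_separated bF eF (fS c) fce (fS i) (ne v) ic _.
  by rewrite fc (inj_eq (@inj_node)).
(* An old vertex that equalled a new one would be joined to it by the empty path. *)
have neq i (v : 'I_(p e)) : v != vc -> f i != node v.
  move=> vvc; apply/eqP => iv; have [ic|ic] := eqVneq (f i) (f c).
    by move: vvc; rewrite -(inj_eq inj_node) -fc -iv ic eqxx.
  by have := sep _ _ ic vvc; rewrite -iv /joined_in connect0.
apply: (IH _ (glue f (@node e \o lift vc)) (e |: F)).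
- have -> : ~: (e |: F) = ~: F :\ e by apply/setP=> u; rewrite !inE negb_or.
  by move: FN; rewrite (cardsD1 e) inE eF add1n => -[].
- apply: glue_inj => //; first exact: inj_comp inj_node (@lift_inj _ _).
  by move=> i v; apply: neq; rewrite eq_sym neq_lift.
- by apply/set0Pn; exists (glue f (@node e \o lift vc) (lshift _ c));
  exact: imset_f.
- have -> : img _ (glue f (@node e \o lift vc)) = img k f :|: blk e.
    apply/setP=> u; rewrite inE;
      apply/imsetP/orP => [[i _ ->]|[/imsetP[i _ ->]|/imsetP[v _ ->]]].
    - by case: (glueP f (@node e \o lift vc) i) => -[v ->] /=; [left|right].
    - by exists (lshift _ i); rewrite // /glue (unsplitK (inl _)).
    - have [w ->|->] := unliftP vc v.
        by exists (rshift k w); rewrite // /glue (unsplitK (inr _)).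
      by exists (lshift _ c); rewrite // /glue (unsplitK (inl _)).
  exact: built_step bF (fS c) fce.
apply: (PS _ _ _ _ _ _ eF fc _ Pf) => i v ic vvc; have nj := sep _ _ ic vvc;
  split.
  (* A common block is a clique, so it would give an edge between the two vertices that avoids
     [f c]. *)
  case=> B [bB iB vB]; have iv := neq i v vvc.
  move/negP: nj; apply; apply: (joined_in_edge _ _ (strong_block_clique hg bB
    iB vB iv)).
    by rewrite !inE.
  by rewrite !inE fc (inj_eq inj_node).
split=> //; [ | by rewrite eq_sym | by rewrite fc (inj_eq inj_node) eq_sym].
rewrite /cut_vertex inE setTD; apply/negP => /connected_onP conn.
by move/negP: nj; apply; apply: conn; rewrite !inE // fc (inj_eq inj_node).
Qed.

End HypertreeInduction.

(** * Division-free formulas over an arbitrary commutative ring *)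

Lemma hypertree_formulas (n : nat) (g : rel 'I_n.+1) (E : finType)
    (p : E -> nat) (node : forall e : E, 'I_(p e) -> 'I_n.+1)
    (R : comNzRingType) (a : E -> R) (m m' : forall e : E, 'I_(p e) -> R)
    (M D : 'M[R]_n.+1) (K := block_kappa a m m') (Q := block_excess a m m') :
  hypertree g -> block_labelling g node -> mul_distance_mx g node m m' M ->
  addmul_distance_mx g node a m m' M D ->
  [/\ forall v0, kappa M D v0 = \prod_e K e,
      \det D = - leibniz_sum K (fun e => a e * Q e) setT &
      cof D = \prod_e K e + leibniz_sum K Q setT].
Proof.
move=> hg hnode [Mblock Mcut] [Dblock Dcut].
(* Every vertex lies in a block, whose matrices determine the diagonal entries. *)
have diag x : M x x = 1 /\ D x x = 0.
  have [B bB xB] := strong_block_vertex g x.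
  case: hnode => _ _ /(_ B)[/(_ bB)[e Be] _]; move: xB;
    rewrite Be => /imsetP[v _ ->].
  by rewrite Mblock Dblock !mxE eqxx subrr mulr0.
have sepC i j v : ~ in_common_block g i j /\ separates g v i j ->
    ~ in_common_block g j i /\ separates g v j i.
  case=> nc [cv vi vj nj]; split; first by case=> B [bB jB iB]; apply: nc;
    exists B.
  by split; rewrite // joined_in_sym.
have base : block_formulas M D a m m' (fun _ : 'I_1 => ord0) set0.
  rewrite /block_formulas !leibniz_sum0 !big_set0 oppr0 addr0.
  have [M0 D0] := diag ord0; split=> [||c].
  + by rewrite det_mx11 mxE D0.
  + rewrite /cof !mxE big_ord1 !mxE big_ord1 !mxE /cofactor det_mx00.
    by rewrite addn0 expr0 !mulr1.
  + rewrite /adjform !mxE big_ord1 !mxE big_ord1 !mxE /cofactor det_mx00.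
    by rewrite addn0 expr0 M0 !mulr1.
have [k [f [injf kn [detf coff kapf]]]] :
    exists k (f : 'I_k -> 'I_n.+1),
      [/\ injective f, k = n.+1 & block_formulas M D a m m' f setT].
  apply: (hypertree_ind hg hnode base).
  move=> k f F e c vc eF fc sep Pf.
  apply: (block_formulas_attach Mblock Dblock eF fc _ _ Pf) => i v.
      (* When one of the two vertices is the attaching vertex, the relations follow from the
         diagonal entries; otherwise that vertex separates them. *)
      have [->|ic] := eqVneq (f i) (f c).
        by have [-> ->] := diag (f c); rewrite add0r !mul1r.
      have [->|vvc] := eqVneq v vc.
        by rewrite -fc; have [-> ->] := diag (f c); rewrite mulr0 addr0 mulr1.
      by have [nc sp] := sep i v ic vvc;
        rewrite (Mcut _ _ _ nc sp) (Dcut _ _ _ nc sp).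
    have [->|ic] := eqVneq (f i) (f c).
      by have [-> ->] := diag (f c); rewrite mulr0 addr0 mulr1.
    have [->|vvc] := eqVneq v vc.
      by rewrite -fc; have [-> ->] := diag (f c); rewrite add0r !mul1r.
    have [nc sp] := sepC _ _ _ (sep i v ic vvc).
    by rewrite (Mcut _ _ _ nc sp) (Dcut _ _ _ nc sp).
have prodT : \prod_(e in [set: E]) K e = \prod_e K e.
  by apply: eq_bigl => e; rewrite inE.
split=> [v0||].
- have [M0 D0] := diag v0; rewrite kappaE // -prodT.
  have /codomP[c ->] : v0 \in codom f by rewrite inj_card_onto // !card_ord kn.
  rewrite -(kapf c) -(adjform_mxsub_inj D _ injf kn); congr adjform.
  by apply/matrixP=> i j; rewrite !mxE.
- by rewrite -(det_mxsub_inj D injf kn).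
- rewrite -prodT -coff [LHS]/cof -/(adjform _ _ _) -(adjform_mxsub_inj D _ injf
  kn).
  by congr adjform; apply/matrixP=> i j; rewrite !mxE.
Qed.

(** * Specialization from the universal polynomial ring *)

Section Morphism.

Context (R S : comNzRingType) (f : {rmorphism R -> S}).

Lemma cof_map_mx n (A : 'M[R]_n) : cof (map_mx f A) = f (cof A).
Proof. by rewrite -[RHS]adjform_map !map_const_mx rmorph1. Qed.

Lemma rmorph_leibniz_sum (E : finType) (K Q : E -> R) (K' Q' : E -> S) F :
  (forall e, f (K e) = K' e) -> (forall e, f (Q e) = Q' e) ->
  f (leibniz_sum K Q F) = leibniz_sum K' Q' F.
Proof.
move=> fK fQ; rewrite rmorph_sum; apply: eq_bigr => e _.
by rewrite rmorphM rmorph_prod fQ; congr (_ * _); apply: eq_bigr.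
Qed.

Context (E : finType) (p : E -> nat).
Context (a : E -> R) (m m' : forall e, 'I_(p e) -> R).
Context (b : E -> S) (l l' : forall e, 'I_(p e) -> S).
Hypotheses (fa : forall e, f (a e) = b e).
Hypotheses (fm : forall e (v : 'I_(p e)), f (m v) = l v).
Hypotheses (fm' : forall e (v : 'I_(p e)), f (m' v) = l' v).

Lemma map_block_mul_mx e :
  map_mx f (block_mul_mx (@m e) (@m' e)) = block_mul_mx (@l e) (@l' e).
Proof.
apply/matrixP=> i j; rewrite !mxE.
by case: eqP => _; rewrite ?rmorph1 // rmorphM fm fm'.
Qed.

Lemma rmorph_block_kappa e : f (block_kappa a m m' e) = block_kappa b l l' e.
Proof. by rewrite rmorphM rmorphXn -det_map_mx map_block_mul_mx fa. Qed.

Lemma rmorph_block_excess e : f (block_excess a m m' e) = block_excess b l l' e.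
Proof.
by rewrite rmorphM rmorphXn rmorphB -det_map_mx -cof_map_mx map_block_mul_mx fa.
Qed.

End Morphism.

Section UniversalData.

Context (E : finType) (p : E -> nat).

Local Notation var x := ('X_(enum_rank (x : indet p)) : data_poly p).

Let X e := var (inl e).
Let Y e (v : 'I_(p e)) := var (inr (inl (Tagged (fun e => 'I_(p e)) v))).
Let Z e (v : 'I_(p e)) := var (inr (inr (Tagged (fun e => 'I_(p e)) v))).

Let ev (R : comNzRingType) (a : E -> R) (m m' : forall e, 'I_(p e) -> R) :
  {rmorphism data_poly p -> R} :=
    mmap intr (fun k => indet_val a m m' (enum_val k)).

Let ev_var (R : comNzRingType) (a : E -> R) (m m' : forall e, 'I_(p e) -> R) x :
  ev a m m' (var x) = indet_val a m m' x.
Proof. by rewrite /ev /= mmapX mmap1U enum_rankK. Qed.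

Let frac : {rmorphism data_poly p -> data_ratfun p} := @tofrac _.

Let ev0 := ev (fun=> 0 : int) (fun _ _ => 0) (fun _ _ => 0).

(** Setting all indeterminates to [0] turns this element into [1]. *)
Let gen_nz e (v : 'I_(p e)) : 1 - gen_m v * gen_m' v != 0.
Proof.
have -> : 1 - gen_m v * gen_m' v = tofrac (1 - Y v * Z v).
  by rewrite rmorphB rmorph1 rmorphM.
rewrite tofrac_eq0; apply: contra_neq (oner_neq0 int) => /(congr1 ev0).
by rewrite rmorph0 rmorphB rmorph1 rmorphM !ev_var mulr0 subr0.
Qed.

(** If it vanished, so would the determinant of the generic block; but at [0] that block is the
    identity matrix. *)
Let gen_sum_nz e : one_plus_sum_d (@gen_m E p) (@gen_m' E p) e != 0.
Proof.
have := @det_block_mul_mx _ _ (@gen_m E p e) (@gen_m' E p e) (@gen_nz e).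
have -> : 1 + \sum_(v < p e) gen_m v * gen_m' v / (1 - gen_m v * gen_m' v) =
    one_plus_sum_d (@gen_m E p) (@gen_m' E p) e.
  rewrite /one_plus_sum_d mxE; congr (_ + _); apply: eq_bigr => v _.
  by rewrite !mxE mul1r.
rewrite -(map_block_mul_mx (f := frac) (m := Y) (m' :=
  Z)) // det_map_mx => detE.
apply/eqP => s0; move/eqP: detE; rewrite s0 mulr0 tofrac_eq0.
move=> /eqP/(congr1 ev0); rewrite rmorph0 -det_map_mx.
suff -> : map_mx ev0 (block_mul_mx (@Y e) (@Z e)) = 1%:M.
  by rewrite det1 => /eqP; rewrite oner_eq0.
apply/matrixP=> i j; rewrite !mxE; case: eqP => _; first by rewrite rmorph1.
by rewrite rmorphM !ev_var mulr0.
Qed.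

Context (R : comNzRingType) (a : E -> R) (m m' : forall e, 'I_(p e) -> R).

Local Notation is_value :=
  (is_polynomial_with_value a m m').

Let K := block_kappa a m m'.
Let Q := block_excess a m m'.
Let KX := block_kappa X Y Z.
Let QX := block_excess X Y Z.
Let KF := block_kappa (@gen_a E p) (@gen_m E p) (@gen_m' E p).
Let QF := block_excess (@gen_a E p) (@gen_m E p) (@gen_m' E p).

Let fracK e : frac (KX e) = KF e. Proof. exact: rmorph_block_kappa. Qed.
Let fracQ e : frac (QX e) = QF e. Proof. exact: rmorph_block_excess. Qed.

Let evX e : ev a m m' (X e) = a e. Proof. exact: ev_var. Qed.
Let evY e v : ev a m m' (@Y e v) = m v. Proof. exact: ev_var. Qed.
Let evZ e v : ev a m m' (@Z e v) = m' v. Proof. exact: ev_var. Qed.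

Let evK e : ev a m m' (KX e) = K e. Proof. exact: rmorph_block_kappa. Qed.
Let evQ e : ev a m m' (QX e) = Q e. Proof. exact: rmorph_block_excess. Qed.

(** The division-free expression over the polynomial ring is the witness: [frac] maps it to the
    rational function and [ev] to the value in [R], as both are ring morphisms. *)
Lemma kappa_rhs_value : is_value
  (kappa_rhs (@gen_a E p) (@gen_m E p) (@gen_m' E p))
  (\prod_e block_kappa a m m' e).
Proof.
exists (\prod_e KX e).
  by rewrite kappa_rhsE // -[LHS]/(frac _) rmorph_prod; apply: eq_bigr.
by rewrite -[LHS]/(ev a m m' _) rmorph_prod; apply: eq_bigr.
Qed.

Lemma det_rhs_value : is_value
  (det_rhs (@gen_a E p) (@gen_m E p) (@gen_m' E p))
  (- leibniz_sum (block_kappa a m m') (fun e => a e * block_excess a m m' e)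
    setT).
Proof.
exists (- leibniz_sum KX (fun e => X e * QX e) setT).
  rewrite det_rhsE // -[LHS]/(frac _) rmorphN; congr (- _);
    apply: rmorph_leibniz_sum => // e.
  by rewrite rmorphM fracQ.
rewrite -[LHS]/(ev a m m' _) rmorphN; congr (- _).
by apply: rmorph_leibniz_sum => // e; rewrite rmorphM evQ evX.
Qed.

Lemma cof_rhs_value : is_value
  (cof_rhs (@gen_a E p) (@gen_m E p) (@gen_m' E p))
  (\prod_e block_kappa a m m' e +
   leibniz_sum (block_kappa a m m') (block_excess a m m') setT).
Proof.
exists (\prod_e KX e + leibniz_sum KX QX setT).
  rewrite cof_rhsE // -[LHS]/(frac _) rmorphD rmorph_prod; congr (_ + _);
    first exact: eq_bigr.
  exact: rmorph_leibniz_sum.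
rewrite -[LHS]/(ev a m m' _) rmorphD rmorph_prod; congr (_ + _).
  exact: eq_bigr.
exact: rmorph_leibniz_sum.
Qed.

End UniversalData.

Theorem proposition2p7 (n : nat) (g : rel 'I_n.+1) (E : finType)
    (p : E -> nat) (node : forall e : E, 'I_(p e) -> 'I_n.+1)
    (R : comNzRingType) (a : E -> R) (m m' : forall e : E, 'I_(p e) -> R)
    (M D : 'M[R]_n.+1)
    (hg : hypertree g)
    (hnode : block_labelling g node)
    (hM : mul_distance_mx g node m m' M)
    (hD : addmul_distance_mx g node a m m' M D) :
  [/\ forall v0 : 'I_n.+1,
        is_polynomial_with_value a m m'
          (kappa_rhs (@gen_a E p) (@gen_m E p) (@gen_m' E p)) (kappa M D v0),
      is_polynomial_with_value a m m'
        (det_rhs (@gen_a E p) (@gen_m E p) (@gen_m' E p)) (\det D) &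
      is_polynomial_with_value a m m'
        (cof_rhs (@gen_a E p) (@gen_m E p) (@gen_m' E p)) (cof D)].
Proof.
have [kappaE -> ->] := hypertree_formulas hg hnode hM hD.
split=> [v0||]; [rewrite kappaE; exact: kappa_rhs_value | |].
  exact: det_rhs_value.
exact: cof_rhs_value.
Qed.
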